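(* Let $n\in\mathbb N$. Let $L_1,\dots,L_n:[0,1]\to[0,\infty)$ be continuous functions with $L_j(0)=0$ and $L_j(t)>0$ for $t\in(0,1)$, such that $\log L_j$ is concave on $(0,1)$. Suppose that for some $c>0$ $$\frac{d}{dt}\log\frac{L_j(t)}{L_j(1-t)}\ge c\quad\text{for } j=1,\dots,n\text{ and almost every }t\in(0,1).$$ Let $w:[0,1]\to[0,\infty)$ be an upper semicontinuous function with at least $n+1$ points of $(0,1)$ where $w\ne0$. Then for every $\alpha_0,\dots,\alpha_n>0$ there exist a unique system $0<y_1<\dots<y_n<1$ and a unique $C>0$ with the following property. For the function $$G(t):=C\,w(t)\prod_{k=1}^nL_k(|t-y_k|),$$ there exist points $z_0,\dots,z_n$ with $$0\le z_0<y_1<z_1<y_2<\dots<z_{n-1}<y_n<z_n\le1,$$ such that $G(z_j)=\alpha_j$ for $j=0,\dots,n$ and $z_j$ is a maximum point of $G$ on $[y_j,y_{j+1}]$ for each $j=0,\dots,n$, where $y_0:=0$ and $y_{n+1}:=1$. *)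

(* Defs.v *)
From HB Require Import structures.
From mathcomp Require Import all_boot all_order all_algebra.
From mathcomp Require Import all_classical all_reals all_analysis.
Set Implicit Arguments. Unset Strict Implicit. Unset Printing Implicit Defensive.
Import Order.TTheory GRing.Theory Num.Theory numFieldNormedType.Exports.
Local Open Scope ring_scope.

Definition concave_on_open (R : realType) (a b : R) (f : R -> R) : Prop :=
  forall x y l : R, a < x < b -> a < y < b -> 0 <= l <= 1 ->
    l * f x + (1 - l) * f y <= f (l * x + (1 - l) * y).

Definition usc_on01 (R : realType) (w : R -> R) : Prop :=
  forall x : R, 0 <= x <= 1 -> forall e : R, 0 < e ->
    exists2 d : R, 0 < d & forall y : R, 0 <= y <= 1 -> `|y - x| < d ->
      w y < w x + e.

(* extended node system: ybar y 0 = 0, ybar y j = y_j (= nth (j-1) y) for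
   1 <= j <= size y, and ybar y (size y + 1) = 1. *)
Definition ybar (R : realType) (y : seq R) (j : nat) : R := nth 1 (0 :: y) j.

Definition Gfun (R : realType) (n : nat) (L : 'I_n -> R -> R) (w : R -> R)
  (y : seq R) (C : R) (t : R) : R :=
  C * w t * \prod_(k < n) L k `|t - ybar y k.+1|.

Definition good_system (R : realType) (n : nat) (L : 'I_n -> R -> R)
  (w : R -> R) (alpha : nat -> R) (y : seq R) (C : R) : Prop :=
  [/\ size y = n,
      (forall j, (j <= n)%N -> ybar y j < ybar y j.+1),
      0 < C &
      exists z : nat -> R,
        [/\ 0 <= z 0%N, z n <= 1 &
          forall j, (j <= n)%N ->
            [/\ (0 < j)%N -> ybar y j < z j,
                (j < n)%N -> z j < ybar y j.+1,
                ybar y j <= z j <= ybar y j.+1,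
                Gfun L w y C (z j) = alpha j &
                forall t, ybar y j <= t <= ybar y j.+1 ->
                  Gfun L w y C t <= Gfun L w y C (z j)]]].

(* Main.v *)
(** Write [M_j(y)] for the maximum of [w(t) prod_k L_k(|t - y_k|)] over
    [[y_j, y_{j+1}]] and [f_j = log M_{j-1} - log M_j], [j = 1, ..., n]; the
    theorem asks for a unique [y] with [f = b], [b_j = log(alpha_{j-1}/alpha_j)].
    Log-concavity of the kernels shows that raising nodes other than [y_j] does
    not increase [f_j]; the lower bound on the derivative of
    [log(L(t)/L(1-t))] shows that raising nodes strictly increases
    [sum_j f_j = log M_0 - log M_n].  So [f] behaves like a strictly column
    diagonally dominant M-matrix.

    Uniqueness: if [f(y) = f(u) = b], then [v = max(y, u)] satisfies [f(v) <= b],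
    so [sum f(v) <= sum f(y)], which forces [v = y], and likewise [v = u].

    Existence: [sum_j |f_j - b_j|] has a minimum, because its sublevel sets lie in
    the set where consecutive maxima have bounded ratios, which is compact and,
    by the [n + 1] points where [w <> 0], avoids the degenerate systems.  At a
    minimum [f = b]: moving [y_j] against the sign of [f_j - b_j] gains in
    coordinate [j] strictly more than it loses in the others. *)
Require Import Defs.
From HB Require Import structures.
From mathcomp Require Import all_boot all_order all_algebra.
From mathcomp Require Import ring lra.
From mathcomp Require Import all_classical all_reals all_analysis.
Import Order.TTheory GRing.Theory Num.Theory numFieldNormedType.Exports.
Local Open Scope classical_set_scope.
Local Open Scope ring_scope.

(** * Logarithmically concave kernels *)

Section Concave.
Variables (R : realType) (K : R -> R).
Hypothesis concK : concave_on_open 0 1 K.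

(** Both chords are compared with the one over [[a, e]]: concavity puts its slope between theirs.
    The slopes are cross-multiplied to avoid quotients. *)
Lemma concave_chord (a b s e : R) : 0 < a -> a < b -> b <= e -> a <= s -> s < e ->
  e < 1 -> (K e - K s) * (b - a) <= (K b - K a) * (e - s).
Proof.
move=> a0 ab be as_ se e1.
have ae : 0 < e - a by lra.
have interp x : a <= x <= e -> (e - x) * K a + (x - a) * K e <= (e - a) * K x.
  move=> /andP[ax xe].
  have := @concK a e ((e - x) / (e - a)).
  have -> : 1 - (e - x) / (e - a) = (x - a) / (e - a) by field; lra.
  have -> : (e - x) / (e - a) * a + (x - a) / (e - a) * e = x by field; lra.
  move=> /(_ _ _ _)/wrap[]; first by lra.
  - by lra.
  - by rewrite divr_ge0 ?ler_pdivrMr//=; lra.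
  rewrite -(ler_pM2l ae); congr (_ <= _); field; lra.
have := interp b; have := interp s.
move=> /(_ ltac:(lra)) Is /(_ ltac:(lra)) Ib.
have Is' : (K e - K s) * (e - a) <= (e - s) * (K e - K a) by lra.
have Ib' : (b - a) * (K e - K a) <= (K b - K a) * (e - a) by lra.
rewrite -(ler_pM2r ae).
have := ler_wpM2r (ltW (_ : 0 < b - a)) Is'.
have := ler_wpM2l (ltW (_ : 0 < e - s)) Ib'.
by move=> /(_ ltac:(lra)) + /(_ ltac:(lra)); lra.
Qed.

(** The chords over [[a, a + p]] and [[a + q, a + p + q]] have the same length, so comparing their
    slopes compares their increments. *)
Lemma concave_swap (a p q : R) : 0 < a -> 0 <= p -> 0 <= q -> a + p + q < 1 ->
  K a + K (a + p + q) <= K (a + p) + K (a + q).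
Proof.
move=> a0 p0 q0 apq.
have [->|pn0] := eqVneq p 0; first by rewrite !addr0.
have p_gt0 : 0 < p by rewrite lt_neqAle eq_sym pn0.
have := @concave_chord a (a + p) (a + q) (a + p + q).
move=> /(_ ltac:(lra) ltac:(lra) ltac:(lra) ltac:(lra) ltac:(lra) ltac:(lra)).
have -> : a + p - a = p by ring.
have -> : a + p + q - (a + q) = p by ring.
by rewrite ler_pM2r//; lra.
Qed.

End Concave.

(** Turns a derivative bound at one point into a bound on short forward increments, the form that
    can be compared with chords of a concave function. *)
Lemma derive1_chord (R : realType) (h : R -> R) (c g e : R) : derivable h g 1 ->
  c <= derive1 h g -> 0 < e ->
  exists2 d, 0 < d & forall t, 0 < t < d -> (c - e) * t <= h (g + t) - h g.
Proof.
move=> dh ch e0.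
have /cvgrPdist_le/(_ _ e0)/nbhs_ballP[d /= d0 near_d] := dh.
exists d => // t /andP[t0 td].
have /(_ _ _) := near_d t; rewrite /ball/= sub0r normrN gtr0_norm// => /(_ td).
rewrite gt_eqF// => /(_ isT).
rewrite -[X in `|X - _|]/('D_1 h g) -derive1E [_ *: 1]mulr1 (addrC t).
move=> /(le_trans (ler_norm _)) le_e.
rewrite -ler_pdivlMr//; apply: le_trans (_ : t^-1 *: (h (g + t) - h g) <= _).
  by lra.
by rewrite [_ *: _]mulrC.
Qed.

(** * Growth of [K(x) - K(1 - x)] for concave [K] *)

Section LogSlope.
Variables (R : realType) (K : R -> R) (c : R).
Hypothesis concK : concave_on_open 0 1 K.
Hypothesis slopeK : forall a b : R, 0 < a -> a < b -> b < 1 ->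
  exists2 g, a < g < b & forall e, 0 < e ->
    exists2 d, 0 < d & forall t, 0 < t < d ->
      (c - e) * t <= (K (g + t) - K (1 - (g + t))) - (K g - K (1 - g)).

(** A single point [g] of [(x, x + d)] with large forward slope suffices. The increments of [K] over
    [[g, g + t]] and over the reflected interval [[1 - g - t, 1 - g]] together are at least nearly
    [c * t], and both chords of length [d] lie to the left of these intervals, so they are at least
    as steep. *)
Lemma log_slope_step (x d : R) : 0 < x - d -> 0 < d -> x + d + d < 1 ->
  c * d <= K x - K (x - d) + (K (1 - x - d) - K (1 - x - d - d)).
Proof.
move=> xd d0 xdd; set S := (X in _ <= X).
have [g /andP[xg gd] Hg] : exists2 g, x < g < x + d & forall e, 0 < e ->
    exists2 d, 0 < d & forall t, 0 < t < d ->
      (c - e) * t <= (K (g + t) - K (1 - (g + t))) - (K g - K (1 - g)).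
  by apply: slopeK; lra.
apply/ler_addgt0Pr => e e0.
have [d1 d10 Hd1] : exists2 d1, 0 < d1 & forall t, 0 < t < d1 ->
    (c - e / d) * t <= (K (g + t) - K (1 - (g + t))) - (K g - K (1 - g)).
  by apply: Hg; rewrite divr_gt0.
(* The second bound keeps [g + t] below [x + d], so that the reflected short chord starts to the
   right of [1 - x - d]. *)
pose t := Num.min (d1 / 2) ((x + d - g) / 2).
have t0 : 0 < t by rewrite lt_min; apply/andP; split; lra.
have td1 : t < d1 by rewrite gt_min; apply/orP; left; lra.
have tg : t < x + d - g by rewrite gt_min; apply/orP; right; lra.
have := Hd1 t; rewrite t0 td1 => /(_ isT) Ht.
have := @concave_chord _ _ concK (x - d) x g (g + t).
move=> /(_ ltac:(lra) ltac:(lra) ltac:(lra) ltac:(lra) ltac:(lra) ltac:(lra)).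
have := @concave_chord _ _ concK (1 - x - d - d) (1 - x - d) (1 - (g + t)) (1 - g).
move=> /(_ ltac:(lra) ltac:(lra) ltac:(lra) ltac:(lra) ltac:(lra) ltac:(lra)).
have -> : 1 - x - d - (1 - x - d - d) = d by ring.
have -> : 1 - g - (1 - (g + t)) = t by ring.
have -> : x - (x - d) = d by ring.
have -> : g + t - g = t by ring.
move=> H2 H1.
have : (c - e / d) * t * d <= S * t.
  apply: (@le_trans _ _ ((K (g + t) - K (1 - (g + t)) - (K g - K (1 - g))) * d)).
    by rewrite ler_wpM2r// ltW.
  rewrite /S; lra.
rewrite mulrAC ler_pM2r// mulrBl divfK ?gt_eqF//.
by rewrite lerBlDr.
Qed.

(** The one-step bounds at [a + i * d], [i < N], telescope in both halves; every argument stays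
    displaced by [d]. *)
Lemma log_slope_sum (a d : R) (N : nat) : 0 < a - d -> 0 < d -> a + N%:R * d + d < 1 ->
  c * (N%:R * d) <= K (a + N%:R * d - d) - K (a - d)
                  + (K (1 - a - d) - K (1 - (a + N%:R * d) - d)).
Proof.
move=> ad d0; elim: N => [|N IH] HN; first by rewrite mul0r !addr0 !subrr mulr0.
have N0 : 0 <= N%:R * d by rewrite mulr_ge0// ltW.
move: HN; rewrite -natr1 mulrDl mul1r => HN.
have := IH ltac:(lra).
have := @log_slope_step (a + N%:R * d).
move=> /(_ d ltac:(lra) d0 ltac:(lra)).
have -> : a + (N%:R * d + d) - d = a + N%:R * d by ring.
have -> : 1 - (a + (N%:R * d + d)) - d = 1 - (a + N%:R * d) - d - d by ring.
by lra.
Qed.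

Hypothesis contK : forall x, 0 < x < 1 -> {for x, continuous K}.

(** Cutting [[a, b]] into [n + 1] equal steps gives the bound with all arguments displaced by one
    step; continuity of [K] removes the displacement in the limit. *)
Lemma log_slope (a b : R) : 0 < a -> a < b -> b < 1 ->
  c * (b - a) <= (K b - K (1 - b)) - (K a - K (1 - a)).
Proof.
move=> a0 ab b1.
pose Phi d := K (b - d) - K (a - d) + (K (1 - a - d) - K (1 - b - d)).
have cvd : (b - a) / n.+1%:R @[n --> \oo] --> 0.
  rewrite -(mulr0 (b - a)); apply: cvgM; [exact: cvg_cst|exact: cvg_harmonic].
have cvK (x : R) : 0 < x < 1 -> K (x - (b - a) / n.+1%:R) @[n --> \oo] --> K x.
  move=> x01; suff cvx : x - (b - a) / n.+1%:R @[n --> \oo] --> x.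
    by apply: (@cvg_comp _ _ _ _ K _ _ _ cvx); exact: contK.
  rewrite -[X in _ --> X]subr0; apply: cvgB; [exact: cvg_cst|exact: cvd].
have : Phi ((b - a) / n.+1%:R) @[n --> \oo] -->
    K b - K a + (K (1 - a) - K (1 - b)).
  by apply: cvgD; apply: cvgB; apply: cvK; lra.
have -> : K b - K a + (K (1 - a) - K (1 - b))
  = K b - K (1 - b) - (K a - K (1 - a)) by ring.
move=> cvPhi; rewrite -(cvg_lim _ cvPhi)//; apply: limr_ge.
  exact: (cvgP _ cvPhi).
have : \forall n \near \oo, (b - a) / n.+1%:R < Num.min a (1 - b).
  by apply: (cvgr_lt 0 cvd); rewrite lt_min a0 subr_gt0.
apply: filterS => n; rewrite lt_min => /andP[da db].
have n0 : n.+1%:R != 0 :> R by rewrite pnatr_eq0.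
have := @log_slope_sum a ((b - a) / n.+1%:R) n.+1.
have -> : n.+1%:R * ((b - a) / n.+1%:R) = b - a by field.
have d0 : 0 < (b - a) / n.+1%:R by apply: divr_gt0; [rewrite subr_gt0|rewrite ltr0n].
have -> : a + (b - a) = b by ring.
by rewrite /Phi; move: ((b - a) / _) da db d0 => d da db d0; apply=> //; lra.
Qed.

End LogSlope.

(** Otherwise the interval, of positive length, would lie in a null set. *)
Lemma ae_itv_ex (R : realType) (P : R -> Prop) (a b : R) : a < b ->
  (\forall t \ae (@lebesgue_measure R), P t) -> exists2 g, a < g < b & P g.
Proof.
move=> ab [N [mN N0 PN]]; apply: contrapT => H.
have abN : `]a, b[ `<=` N.
  by move=> x /=; rewrite in_itv /= => xab; apply: PN => /= Px; apply: H; exists x.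
have : (lebesgue_measure `]a, b[%classic <= lebesgue_measure N)%E.
  by apply: le_measure; rewrite ?inE//; exact: measurable_itv.
rewrite [X in (_ <= X)%E]N0 lebesgue_measure_itv /= lte_fin ab -EFinD lee_fin.
by rewrite leNgt subr_gt0 ab.
Qed.

(** * Inequalities for a single kernel *)

Section LogConcaveFactor.
Variables (R : realType) (L : R -> R) (c : R).
Hypothesis contL : {within `[0, 1], continuous L}.
Hypothesis L_ge0 : forall t, 0 <= t <= 1 -> 0 <= L t.
Hypothesis L0 : L 0 = 0.
Hypothesis L_gt0 : forall t, 0 < t < 1 -> 0 < L t.
Hypothesis concL : concave_on_open 0 1 (fun t => ln (L t)).
Hypothesis c0 : 0 < c.
Hypothesis slopeL : \forall t \ae (@lebesgue_measure R), 0 < t < 1 ->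
      derivable (fun s => ln (L s / L (1 - s))) t 1 /\
      c <= derive1 (fun s => ln (L s / L (1 - s))) t.

(** Multiplicative form of [concave_swap]; the value [a = 0] is allowed because [L 0 = 0]
    annihilates the left side. *)
Lemma factor_swap (a p q : R) : 0 <= a -> 0 <= p -> 0 <= q -> a + p + q < 1 ->
  L a * L (a + p + q) <= L (a + p) * L (a + q).
Proof.
move=> a0 p0 q0 apq.
have [->|an0] := eqVneq a 0.
  by rewrite L0 mul0r mulr_ge0// L_ge0//; lra.
have a_gt0 : 0 < a by rewrite lt_neqAle eq_sym an0.
have la : 0 < L a by apply: L_gt0; lra.
have lap : 0 < L (a + p) by apply: L_gt0; lra.
have laq : 0 < L (a + q) by apply: L_gt0; lra.
have lapq : 0 < L (a + p + q) by apply: L_gt0; lra.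
rewrite -ler_ln ?posrE ?mulr_gt0// !lnM ?posrE//.
by apply: (@concave_swap R (fun t => ln (L t)) concL).
Qed.

(** The logarithm of [L t / L (1 - t)] grows at rate at least [c > 0]. *)
Lemma factor_ratio_lt (a b : R) : 0 < a -> a < b -> b < 1 ->
  L a * L (1 - b) < L b * L (1 - a).
Proof.
move=> a0 ab b1.
have la : 0 < L a by apply: L_gt0; lra.
have lb : 0 < L b by apply: L_gt0; lra.
have l1a : 0 < L (1 - a) by apply: L_gt0; lra.
have l1b : 0 < L (1 - b) by apply: L_gt0; lra.
rewrite -ltr_ln ?posrE ?mulr_gt0// !lnM ?posrE//.
have cab : 0 < c * (b - a) by apply: mulr_gt0 => //; lra.
suff : c * (b - a) <= (ln (L b) - ln (L (1 - b))) - (ln (L a) - ln (L (1 - a))) by lra.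
apply: (@log_slope R (fun t => ln (L t)) c) => // {a b a0 ab b1 la lb l1a l1b cab}.
  move=> a b a0 ab b1.
  have [g /andP[ag gb] Hg] := ae_itv_ex _ _ _ _ ab slopeL.
  exists g => [|e e0]; first by rewrite ag.
  have g01 : 0 < g < 1 by lra.
  have [dg cg] := Hg g01.
  have [d d0 Hd] := derive1_chord _ _ _ _ _ dg cg e0.
  (* The bound [1 - g] keeps [g + t] in [(0, 1)], where the logarithm of the quotient splits. *)
  exists (Num.min d (1 - g)); first by rewrite lt_min d0 subr_gt0; lra.
  move=> t; rewrite lt_min => /andP[t0 /andP[td tg]].
  have := Hd t; rewrite t0 td => /(_ isT).
  rewrite !ln_div ?posrE ?L_gt0//; lra.
move=> x x01; apply: (@continuous_comp _ _ _ L (@ln R)); last exact/continuous_ln/L_gt0.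
have /continuous_within_itvP := contL.
by move=> /(_ ltr01)[+ _ _]; apply; rewrite in_itv.
Qed.

(* Moving a node from [y] to [u] shifts weight from the maximum on its right
   to the maximum on its left. *)
Lemma factor_cross_lt (s t y u : R) : 0 <= s -> t <= 1 -> s < y -> y < u -> u < t ->
  L (y - s) * L (t - u) < L (u - s) * L (t - y).
Proof.
move=> s0 t1 sy yu ut.
(* The arguments [t - u] and [t - y], translated by [1 + s - t], become [1 - (u - s)] and
   [1 - (y - s)]. Multiplying this swap with the strict ratio inequality cancels the kernel values
   at the translated arguments. *)
have := @factor_swap (t - u) (u - y) (1 + s - t).
move=> /(_ ltac:(lra) ltac:(lra) ltac:(lra) ltac:(lra)).
have -> : t - u + (u - y) + (1 + s - t) = 1 - (y - s) by ring.
have -> : t - u + (u - y) = t - y by ring.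
have -> : t - u + (1 + s - t) = 1 - (u - s) by ring.
have := @factor_ratio_lt (y - s) (u - s).
move=> /(_ ltac:(lra) ltac:(lra) ltac:(lra)) H1 H2.
have l1 : 0 < L (1 - (y - s)) by apply: L_gt0; lra.
have l2 : 0 < L (1 - (u - s)) by apply: L_gt0; lra.
have l3 : 0 < L (t - u) by apply: L_gt0; lra.
have l4 : 0 < L (u - s) by apply: L_gt0; lra.
rewrite -(ltr_pM2r (mulr_gt0 l1 l2)).
have := ler_wpM2r (ltW (mulr_gt0 l4 l1)) H2.
have H3 : L (y - s) * L (1 - (u - s)) * (L (t - u) * L (1 - (y - s))) <
  L (u - s) * L (1 - (y - s)) * (L (t - u) * L (1 - (y - s))).
  by rewrite ltr_pM2r ?mulr_gt0.
have := ler_wpM2r (ltW l2) (ler_wpM2r (ltW l4) H2).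
lra.
Qed.

End LogConcaveFactor.

(** * Semicontinuity and uniform continuity *)

(** Near each point some gap below [S] persists by semicontinuity; compactness, applied with [e]
    tending to [0] from the right, gives one gap for the whole interval. *)
Lemma usc_itv_lt (R : realType) (g : R -> R) (a b : R) (S : R) : usc_on01 g ->
  0 <= a -> b <= 1 -> (forall x, a <= x <= b -> g x < S) ->
  exists2 S', S' < S & forall x, a <= x <= b -> g x < S'.
Proof.
move=> uscg a0 b1 gS.
have /compact_near_coveringP/near_covering_withinP cover := @segment_compact R a b.
have := cover _ (0:R)^'+ (fun e x => g x < S - e) _.
move=> /(_ _)[x /=|e /= e0 He].
  rewrite in_itv/= => xab.
  have x01 : 0 <= x <= 1 by lra.
  have gSx : 0 < (S - g x) / 2 by have := gS _ xab; lra.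
  have [d d0 Hd] := uscg x x01 _ gSx.
  near=> x' e => /=; rewrite in_itv/= => x'ab.
  have : g x' < g x + (S - g x) / 2.
    apply: Hd; first by lra.
    by rewrite distrC; near: x'; exact: nbhsx_ballx.
  have : e < (S - g x) / 2 by near: e; exact: nbhs_right_lt.
  lra.
exists (S - e / 2); first by rewrite ltrBlDr ltrDl divr_gt0.
move=> x xab.
have := He (e / 2) => /(_ _ _ x)/=; apply; last by rewrite in_itv.
  by rewrite /ball/= sub0r normrN gtr0_norm ?divr_gt0//; lra.
by rewrite divr_gt0.
Unshelve. all: by end_near. Qed.

Lemma usc_itv_bounded (R : realType) (g : R -> R) (a b : R) : usc_on01 g ->
  0 <= a -> b <= 1 -> exists2 S, 0 < S & forall x, a <= x <= b -> g x < S.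
Proof.
move=> uscg a0 b1.
have /compact_near_coveringP/near_covering_withinP cover := @segment_compact R a b.
have := cover _ (+oo : set_system R) (fun M x => g x < M) _.
move=> /(_ _)[x /=|N /= [Nr HN]].
  rewrite in_itv/= => xab.
  have x01 : 0 <= x <= 1 by lra.
  have [d d0 Hd] := uscg x x01 _ ltr01.
  near=> x' M => /=; rewrite in_itv/= => x'ab.
  apply: (@lt_trans _ _ (g x + 1)).
    apply: Hd; first by lra.
    by rewrite distrC; near: x'; exact: nbhsx_ballx.
  by near: M; apply: nbhs_pinfty_gt; rewrite num_real.
exists (Num.max N 0 + 1); first by rewrite ltr_wpDl// le_max lexx orbT.
move=> x xab; apply: HN; last by rewrite /= in_itv.
by rewrite (@le_lt_trans _ _ (Num.max N 0)) ?ltrDl// le_max lexx.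
Unshelve. all: by end_near. Qed.

(** If the supremum were not attained, [usc_itv_lt] would produce a smaller upper bound. *)
Lemma usc_itv_max (R : realType) (g : R -> R) (a b : R) : usc_on01 g ->
  0 <= a -> a <= b -> b <= 1 ->
  exists2 z, a <= z <= b & forall t, a <= t <= b -> g t <= g z.
Proof.
move=> uscg a0 ab b1.
have [B B0 gB] := usc_itv_bounded _ _ _ _ uscg a0 b1.
pose E := [set g t | t in [set t | a <= t <= b]].
have hsE : has_sup E.
  split; first by exists (g a), a => //=; rewrite lexx.
  by exists B => _ [t /= tab <-]; exact/ltW/gB.
apply: contrapT => nomax.
have [|S' ltS' gS'] := @usc_itv_lt _ g a b (sup E) uscg a0 b1.
  move=> x xab; rewrite ltNge; apply/negP => Sgx; apply: nomax; exists x => // t tab.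
  by apply: le_trans Sgx; apply: sup_upper_bound => //; exists t.
move: ltS'; rewrite ltNge => /negP; apply; apply: ge_sup; first by have [] := hsE.
by move=> _ [t /= tab <-]; exact/ltW/gS'.
Qed.

Lemma itv_uniform_continuous (R : realType) (f : R -> R) (e : R) :
  {within `[0, 1], continuous f} -> 0 < e ->
  exists2 d, 0 < d & forall x y, 0 <= x <= 1 -> 0 <= y <= 1 -> `|x - y| < d ->
    `|f x - f y| < e.
Proof.
move=> /subspace_continuousP cf e0.
have /compact_near_coveringP/near_covering_withinP cover := @segment_compact R 0 1.
have e20 : 0 < e / 2 by rewrite divr_gt0.
have := cover _ (0:R)^'+ (fun d x => forall y, 0 <= y <= 1 -> `|x - y| < d ->
    `|f x - f y| < e) _.
move=> /(_ _)[x /=|d /= d0 Hd].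
  move=> x01.
  have /cvgrPdist_lt/(_ _ e20) := cf x x01.
  rewrite near_withinE => /nbhs_ballP[d /= d0 Hd].
  near=> x' r => /= x'01 y y01 x'y.
  have xx' : `|x - x'| < d / 2.
    by near: x'; apply: nbhsx_ballx; rewrite divr_gt0.
  have rd : r < d / 2 by near: r; apply: nbhs_right_lt; rewrite divr_gt0.
  have H1 : `|f x - f x'| < e / 2 by apply: Hd => //; rewrite /ball/=; lra.
  have H2 : `|f x - f y| < e / 2.
    apply: Hd; last by rewrite /= in_itv.
    rewrite /ball/= -(subrKA x' x); apply: le_lt_trans (ler_normD _ _) _; lra.
  rewrite -(subrKA (f x)); apply: le_lt_trans (ler_normD _ _) _.
  by rewrite (distrC (f x')); lra.
exists (d / 2); first by rewrite divr_gt0.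
move=> x y x01 y01 xy.
apply: (Hd (d / 2) _ _ x) => //.
- by rewrite /ball/= sub0r normrN gtr0_norm ?divr_gt0//; lra.
- by rewrite /= divr_gt0.
Unshelve. all: by end_near. Qed.

(** * Uniform continuity of finite products *)

Section ProductContinuity.
Variables (R : realType) (I : Type) (L : I -> R -> R).
Hypothesis contL : forall k, {within `[0, 1], continuous (L k)}.

Let in01 (x : I -> R) := forall k, 0 <= x k <= 1.

Lemma prod_bounded (r : seq I) : exists2 B, 0 < B & forall x : I -> R, in01 x ->
  `|\prod_(k <- r) L k (x k)| <= B.
Proof.
elim: r => [|i r [B B0 HB]]; first by exists 1 => // x _; rewrite big_nil normr1.
have /(EVT_max ler01)[z z01 Hz] : {within `[0, 1], continuous (fun t => `|L i t|)}.
  move=> t; apply: (@continuous_comp (subspace _) _ _ (L i) (fun u : R => `|u|) t).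
    exact: contL.
  exact: norm_continuous.
exists ((`|L i z| + 1) * B) => [|x x01]; first by rewrite mulr_gt0// ltr_wpDl.
rewrite big_cons normrM ler_pM// ?HB//.
by apply: le_trans (Hz _ _) _; rewrite ?in_itv/= ?x01// lerDl.
Qed.

Lemma prod_uniform_continuous (r : seq I) (e : R) : 0 < e ->
  exists2 d, 0 < d & forall x y : I -> R, in01 x -> in01 y ->
    (forall k, `|x k - y k| < d) ->
    `|\prod_(k <- r) L k (x k) - \prod_(k <- r) L k (y k)| < e.
Proof.
elim: r e => [|i r IH] e e0.
  by exists 1 => // x y _ _ _; rewrite !big_nil subrr normr0.
have [B B0 HB] := prod_bounded r.
have [A A0 HA] := prod_bounded [:: i].
have eA : 0 < e / (2 * A) by rewrite divr_gt0// mulr_gt0.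
have eB : 0 < e / (2 * B) by rewrite divr_gt0// mulr_gt0.
have [d1 d10 H1] := IH _ eA.
have [d2 d20 H2] := itv_uniform_continuous _ _ _ (contL i) eB.
exists (Num.min d1 d2) => [|x y x01 y01 xy]; first by rewrite lt_min d10.
have {}H1 : `|\prod_(k <- r) L k (x k) - \prod_(k <- r) L k (y k)| < e / (2 * A).
  by apply: H1 => // k; have := xy k; rewrite lt_min => /andP[].
have {}H2 : `|L i (x i) - L i (y i)| < e / (2 * B).
  by apply: H2 => //; have := xy i; rewrite lt_min => /andP[].
have := HA _ x01; have := HB _ y01; rewrite !big_cons big_nil mulr1.
set p := \prod_(k <- r) L k (x k) in H1 *.
set q := \prod_(k <- r) L k (y k) in H1 *.
move: (L i (x i)) (L i (y i)) H2 => a b H2 qB aA.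
have -> : a * p - b * q = a * (p - q) + (a - b) * q by ring.
apply: le_lt_trans (ler_normD _ _) _; rewrite !normrM.
apply: (@le_lt_trans _ _ (A * `|p - q| + `|a - b| * B)).
  by rewrite lerD// ?ler_wpM2r// ler_wpM2l.
have -> : e = A * (e / (2 * A)) + e / (2 * B) * B by field; rewrite !gt_eqF.
by rewrite ltrD// ?ltr_pM2l// ltr_pM2r.
Qed.

End ProductContinuity.

(** * Interval maxima *)

Section Nodes.
Variables (R : realType) (n : nat) (L : 'I_n -> R -> R) (w : R -> R).

Definition node_prod (Y : nat -> R) (t : R) : R := \prod_(k < n) L k `|t - Y k.+1|.
Definition node_fun (Y : nat -> R) (t : R) : R := w t * node_prod Y t.
Definition node_max (Y : nat -> R) (j : nat) : R :=
  sup [set node_fun Y t | t in [set t | Y j <= t <= Y j.+1]].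
(** Coinciding nodes and nodes at the ends are allowed, which makes the set of systems closed. The
    fixed ends are stored at indices [0] and [n + 1]. *)
Definition simplex (Y : nat -> R) : Prop :=
  [/\ Y 0%N = 0, Y n.+1 = 1 & forall j, (j <= n)%N -> Y j <= Y j.+1].

Local Notation F := node_fun.
Local Notation M := node_max.

Lemma simplex_le (Y : nat -> R) (i j : nat) : simplex Y ->
  (i <= j)%N -> (j <= n.+1)%N -> Y i <= Y j.
Proof.
move=> [_ _ mono]; elim: j => [|j IH]; first by rewrite leqn0 => /eqP ->.
rewrite leq_eqVlt => /predU1P[->//|ij] jn.
by apply: le_trans (mono _ _) => //; apply: IH => //; exact: ltnW.
Qed.

Lemma simplex01 (Y : nat -> R) (j : nat) : simplex Y -> (j <= n.+1)%N -> 0 <= Y j <= 1.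
Proof.
move=> sY jn; have [Y0 Y1 _] := sY.
by rewrite -{1}Y0 -Y1 !simplex_le.
Qed.

Lemma node_fun_eq (Y U : nat -> R) (t : R) : (forall k, (k <= n.+1)%N -> Y k = U k) ->
  F Y t = F U t.
Proof.
by move=> YU; congr (_ * _); apply: eq_bigr => k _; rewrite YU// ltnS ltnW.
Qed.

Lemma node_max_eq (Y U : nat -> R) (j : nat) : (j <= n)%N ->
  (forall k, (k <= n.+1)%N -> Y k = U k) -> M Y j = M U j.
Proof.
move=> jn YU; rewrite /M !YU//; last exact: leqW.
by congr (sup (image _ _)); apply/funext => t; exact: node_fun_eq.
Qed.

Hypothesis contL : forall k, {within `[0, 1], continuous (L k)}.
Hypothesis L_ge0 : forall k t, 0 <= t <= 1 -> 0 <= L k t.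
Hypothesis L0 : forall k, L k 0 = 0.
Hypothesis L_gt0 : forall k t, 0 < t < 1 -> 0 < L k t.
Hypothesis w_ge0 : forall t, 0 <= t <= 1 -> 0 <= w t.
Hypothesis uscw : usc_on01 w.

Let dist01 (x y : R) : 0 <= x <= 1 -> 0 <= y <= 1 -> 0 <= `|x - y| <= 1.
Proof. by move=> x01 y01; rewrite normr_ge0/= ler_norml; lra. Qed.

Let in01 (Y : nat -> R) := forall k, (k < n)%N -> 0 <= Y k.+1 <= 1.

Let simplex_in01 Y : simplex Y -> in01 Y.
Proof. by move=> sY k kn; apply: simplex01 => //; rewrite ltnS ltnW. Qed.

Lemma node_prod_ge0 (Y : nat -> R) (t : R) : in01 Y -> 0 <= t <= 1 -> 0 <= node_prod Y t.
Proof. by move=> Y01 t01; apply: prodr_ge0 => k _; rewrite L_ge0// dist01// Y01. Qed.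

Lemma node_fun_ge0 (Y : nat -> R) (t : R) : in01 Y -> 0 <= t <= 1 -> 0 <= F Y t.
Proof. by move=> Y01 t01; rewrite mulr_ge0 ?w_ge0 ?node_prod_ge0. Qed.

Lemma node_fun_at_node (Y : nat -> R) (k : nat) : (0 < k <= n)%N -> F Y (Y k) = 0.
Proof.
case: k => // k kn; rewrite /F /node_prod (bigD1 (Ordinal kn))//=.
by rewrite subrr normr0 L0 mul0r mulr0.
Qed.

Lemma node_fun_gt0 (Y : nat -> R) (t : R) : 0 <= t <= 1 -> 0 < w t ->
  (forall k, (k < n)%N -> t != Y k.+1 /\ `|t - Y k.+1| < 1) -> 0 < F Y t.
Proof.
move=> t01 wt HY; rewrite mulr_gt0//; apply: prodr_gt0 => k _; apply: L_gt0.
have [tY tY1] := HY k (ltn_ord k).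
by rewrite normr_gt0 subr_eq0 tY.
Qed.

(** Stated through the differences [t - Y k.+1], so that one modulus serves both for moving nodes
    and for moving [t]. *)
Lemma node_prod_uniform (e : R) : 0 < e ->
  exists2 d, 0 < d & forall Y U t u, in01 Y -> in01 U -> 0 <= t <= 1 -> 0 <= u <= 1 ->
    (forall k, (k < n)%N -> `|(t - Y k.+1) - (u - U k.+1)| < d) ->
    `|node_prod Y t - node_prod U u| < e.
Proof.
move=> e0; have [d d0 Hd] := prod_uniform_continuous _ _ L contL (index_enum 'I_n) _ e0.
exists d => // Y U t u Y01 U01 t01 u01 YU.
apply: (Hd (fun k : 'I_n => `|t - Y k.+1|) (fun k : 'I_n => `|u - U k.+1|)).
- by move=> k; rewrite dist01// Y01.
- by move=> k; rewrite dist01// U01.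
- by move=> k; apply: le_lt_trans (ler_dist_dist _ _) (YU _ _).
Qed.

Lemma node_fun_uniform (e : R) : 0 < e ->
  exists2 d, 0 < d & forall Y U t, in01 Y -> in01 U -> 0 <= t <= 1 ->
    (forall k, (k < n)%N -> `|Y k.+1 - U k.+1| < d) -> `|F Y t - F U t| < e.
Proof.
move=> e0; have [W W0 wW] := usc_itv_bounded _ _ _ _ uscw (lexx 0) (lexx 1).
have [d d0 Hd] := node_prod_uniform _ (divr_gt0 e0 W0).
exists d => // Y U t Y01 U01 t01 YU.
rewrite -mulrBr normrM (ger0_norm (w_ge0 _ t01)).
apply: (@le_lt_trans _ _ (W * `|node_prod Y t - node_prod U t|)).
  by rewrite ler_wpM2r// ltW// wW.
rewrite -ltr_pdivlMl// mulrC; apply: Hd => // k kn.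
have -> : t - Y k.+1 - (t - U k.+1) = U k.+1 - Y k.+1 by ring.
by rewrite distrC; exact: YU.
Qed.

(** Moving node [k] onto [t] makes the function vanish at [t], and this small move changes its value
    by less than [e]. *)
Lemma node_fun_near_node (e : R) : 0 < e ->
  exists2 d, 0 < d & forall Y t k, in01 Y -> 0 <= t <= 1 -> (0 < k <= n)%N ->
    `|t - Y k| < d -> F Y t < e.
Proof.
move=> e0; have [d d0 Hd] := node_fun_uniform _ e0; exists d => // Y t k Y01 t01 kn tY.
pose U i := if i == k then t else Y i.
have U01 : in01 U by move=> i iN; rewrite /U; case: ifP => // _; exact: Y01.
have := Hd Y U t Y01 U01 t01.
have -> : F U t = 0 by have := node_fun_at_node U k kn; rewrite /U eqxx.
rewrite subr0 => /(_ _)/wrap[i iN|]; last exact/le_lt_trans/ler_norm.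
by rewrite /U; case: eqP => [->|_]; rewrite ?subrr ?normr0// distrC.
Qed.

Lemma node_fun_usc (Y : nat -> R) : in01 Y -> usc_on01 (F Y).
Proof.
move=> Y01 x x01 e e0; pose P := node_prod Y x; pose W := w x + P + 1.
have P0 : 0 <= P by exact: node_prod_ge0.
have W0 : 0 < W by rewrite ltr_wpDl// addr_ge0// w_ge0.
(* As [r <= 1], the product of [w x + r] and [P + r] is at most [w x * P + r * W], and
   [r * W <= e / 2]. *)
pose r := Num.min 1 (e / (2 * W)).
have r0 : 0 < r by rewrite lt_min ltr01 divr_gt0// mulr_gt0.
have [d1 d10 H1] := uscw x x01 _ r0.
have [d2 d20 H2] := node_prod_uniform _ r0.
exists (Num.min d1 d2) => [|y y01]; first by rewrite lt_min d10.
rewrite lt_min => /andP[/(H1 _ y01) wy yx].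
have Py : node_prod Y y < P + r.
  rewrite -ltrBlDl; apply: le_lt_trans (ler_norm _) _; apply: H2 => // k kn.
  by have -> : y - Y k.+1 - (x - Y k.+1) = y - x by ring.
have r1 : r <= 1 by rewrite ge_min lexx.
have rW : r * W <= e / 2.
  rewrite -ler_pdivlMr// -mulrA -invfM ge_min; apply/orP; right.
  by rewrite (mulrC 2).
apply: (@le_lt_trans _ _ ((w x + r) * (P + r))).
  by rewrite ler_pM ?w_ge0 ?node_prod_ge0// ltW.
have rr : r * r <= r by rewrite ger_pMr.
have : r * W = r * w x + r * P + r by rewrite /W; ring.
rewrite {1}/F -/P; lra.
Qed.

Lemma node_maxP (Y : nat -> R) (j : nat) : simplex Y -> (j <= n)%N ->
  exists2 z, Y j <= z <= Y j.+1 &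
    F Y z = M Y j /\ forall t, Y j <= t <= Y j.+1 -> F Y t <= F Y z.
Proof.
move=> sY jn.
have /andP[Yj0 _] := simplex01 Y j sY (leqW jn).
have /andP[_ Yj1] := simplex01 Y j.+1 sY jn.
have Yj := simplex_le Y j j.+1 sY (leqnSn j) jn.
have [z zY Hz] := usc_itv_max _ _ _ _ (node_fun_usc _ (simplex_in01 _ sY)) Yj0 Yj Yj1.
exists z => //; split=> //; apply/eqP; rewrite eq_le; apply/andP; split.
  apply: sup_upper_bound; last by exists z.
  by split; [exists (F Y z), z|exists (F Y z) => _ [t /= tY <-]; exact: Hz].
by apply: ge_sup => [|_ [t /= tY <-]]; [exists (F Y z), z|exact: Hz].
Qed.

Lemma node_max_ge (Y : nat -> R) (j : nat) (t : R) : simplex Y -> (j <= n)%N ->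
  Y j <= t <= Y j.+1 -> F Y t <= M Y j.
Proof. by move=> sY jn tY; have [z zY [<- ->]] := node_maxP _ _ sY jn. Qed.

Lemma simplex_itv01 (Y : nat -> R) (j : nat) (t : R) : simplex Y -> (j <= n)%N ->
  Y j <= t <= Y j.+1 -> 0 <= t <= 1.
Proof.
move=> sY jn; have := simplex01 Y j sY (leqW jn); have := simplex01 Y j.+1 sY jn.
by move=> ? ? ?; lra.
Qed.

Lemma node_max_ge0 (Y : nat -> R) (j : nat) : simplex Y -> (j <= n)%N -> 0 <= M Y j.
Proof.
move=> sY jn; have [z zY [<- _]] := node_maxP _ _ sY jn.
by apply: node_fun_ge0; [exact: simplex_in01|exact: simplex_itv01 zY].
Qed.

(** Let [z] be a maximum point for [Y]. If it lies in the corresponding interval of [U], both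
    functions are compared at [z]. Otherwise [z] is caught between a node of [Y] and its displaced
    copy in [U], so the value at [z] is already below [e]. *)
Lemma node_max_uniform (e : R) : 0 < e ->
  exists2 d, 0 < d & forall Y U, simplex Y -> simplex U ->
    (forall k, (k < n)%N -> `|Y k.+1 - U k.+1| < d) ->
    forall j, (j <= n)%N -> M Y j <= M U j + e.
Proof.
move=> e0; have [d1 d10 H1] := node_fun_uniform _ e0.
have [d2 d20 H2] := node_fun_near_node _ e0.
exists (Num.min d1 d2) => [|Y U sY sU YU j jn]; first by rewrite lt_min d10.
have [z zY [<- _]] := node_maxP _ _ sY jn.
have z01 := simplex_itv01 _ _ _ sY jn zY.
have [Y0 Y1 _] := sY; have [U0 U1 _] := sU.
(* The condition [Y i != U i] rules out the fixed end [i = 0], where the function need not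
   vanish. *)
have near i : (i <= n)%N -> `|z - Y i| < d2 -> Y i != U i -> F Y z < e.
  move=> iN zi YUi; apply: (H2 _ _ i (simplex_in01 _ sY)) => //.
  by rewrite iN andbT lt0n; apply: contra_neq YUi => ->; rewrite Y0 U0.
have d2' i : (i <= n.+1)%N -> Y i != U i -> `|Y i - U i| < d2.
  case: i => [|i]; first by rewrite Y0 U0 eqxx.
  rewrite ltnS leq_eqVlt => /predU1P[->|iN] _; first by rewrite Y1 U1 subrr normr0.
  by have := YU _ iN; rewrite lt_min => /andP[].
have MU0 := node_max_ge0 U j sU jn.
have [zU|Uz] := leP z (U j.+1); last first.
  have ne : Y j.+1 != U j.+1 by rewrite gt_eqF//; lra.
  have jn' : (j < n)%N.
    by rewrite ltn_neqAle jn andbT; apply: contra_neq ne => ->; rewrite Y1 U1.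
  suff : F Y z < e by lra.
  apply: (near j.+1) => //; have := d2' j.+1 jn ne.
  by rewrite !ltr_norml; lra.
have [Uz|zU'] := leP (U j) z; last first.
  have ne : Y j != U j by rewrite lt_eqF//; lra.
  suff : F Y z < e by lra.
  apply: (near j) => //; have := d2' j (leqW jn) ne.
  by rewrite !ltr_norml; lra.
have := node_max_ge U j z sU jn; rewrite Uz zU => /(_ isT).
suff : `|F Y z - F U z| < e by rewrite ltr_norml; lra.
apply: H1 => //; [exact: simplex_in01|exact: simplex_in01|].
by move=> k kn; have := YU k kn; rewrite lt_min => /andP[].
Qed.

(** Nondegenerate systems: positive maxima have meaningful logarithms and force the nodes to be
    strictly ordered and interior. *)
Definition regular (Y : nat -> R) : Prop :=
  simplex Y /\ forall j, (j <= n)%N -> 0 < M Y j.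

Lemma node_fun_pos_lt (Y : nat -> R) (j : nat) (z : R) : Y j <= z <= Y j.+1 ->
  0 < F Y z -> ((0 < j <= n)%N -> Y j < z) /\ ((j < n)%N -> z < Y j.+1).
Proof.
move=> /andP[Yz zY] Fz; split=> jn; rewrite lt_neqAle ?Yz ?zY andbT.
  by apply: contraTneq Fz => <-; rewrite node_fun_at_node ?ltxx.
by apply: contraTneq Fz => ->; rewrite node_fun_at_node ?ltxx.
Qed.

Lemma regular_maxP (Y : nat -> R) (j : nat) : regular Y -> (j <= n)%N ->
  exists z, [/\ Y j <= z <= Y j.+1, (0 < j)%N -> Y j < z,
    (j < n)%N -> z < Y j.+1, F Y z = M Y j &
    forall t, Y j <= t <= Y j.+1 -> F Y t <= F Y z].
Proof.
move=> [sY Mpos] jn; have [z zY [Fz Hz]] := node_maxP _ _ sY jn.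
have Fz0 : 0 < F Y z by rewrite Fz Mpos.
have [Y1 Y2] := node_fun_pos_lt _ _ _ zY Fz0.
by exists z; split=> // j0; apply: Y1; rewrite j0.
Qed.

Lemma regular_lt (Y : nat -> R) (j : nat) : regular Y -> (j <= n)%N -> Y j < Y j.+1.
Proof.
move=> rY jn; have [z [/andP[Yz zY] H1 H2 _ _]] := regular_maxP _ _ rY jn.
have [j0|] := ltnP 0 j; first exact: lt_le_trans (H1 j0) zY.
rewrite leqn0 => /eqP j0; move: jn; rewrite leq_eqVlt => /predU1P[jn|jn].
  have [[Y0 Y1 _] _] := rY; have n0 : n = 0%N by rewrite -jn.
  by rewrite {1}j0 jn Y0 Y1 ltr01.
exact: le_lt_trans Yz (H2 jn).
Qed.

Lemma regular_interior (Y : nat -> R) (k : nat) : regular Y -> (k < n)%N ->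
  0 < Y k.+1 < 1.
Proof.
move=> rY kn; have [sY _] := rY; have [Y0 Y1 _] := sY.
have := regular_lt Y 0 rY (leq0n n); rewrite Y0 => /lt_le_trans -> /=.
  by apply: le_lt_trans (simplex_le Y k.+1 n sY kn (leqnSn n)) _; rewrite -Y1 regular_lt.
by apply: simplex_le => //; rewrite ltnS ltnW.
Qed.

(** Positivity criterion by one point of positive weight between neighbouring nodes. Interior nodes
    keep every distance below [1], where the kernels are known to be positive. *)
Lemma node_max_gt0 (Y : nat -> R) (j : nat) (z : R) : simplex Y -> (j <= n)%N ->
  (forall k, (k < n)%N -> 0 < Y k.+1 < 1) ->
  0 <= z <= 1 -> 0 < w z -> ((0 < j)%N -> Y j < z) -> ((j < n)%N -> z < Y j.+1) ->
  0 < M Y j.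
Proof.
move=> sY jn Yint z01 wz Yz zY; have [Y0 Y1 _] := sY.
have zj : Y j <= z <= Y j.+1.
  apply/andP; split.
    by case: (posnP j) => [->|/Yz/ltW//]; rewrite Y0; case/andP: z01.
  move: jn; rewrite leq_eqVlt => /predU1P[->|/zY/ltW//].
  by rewrite Y1; case/andP: z01.
apply: lt_le_trans (node_max_ge _ _ _ sY jn zj); apply: node_fun_gt0 => // k kn.
split; last by have := Yint _ kn; rewrite ltr_norml; lra.
have [kj|jk] := ltnP k j.
  rewrite gt_eqF//; apply: le_lt_trans (Yz _); last exact: leq_ltn_trans kj.
  by apply: simplex_le => //; exact: leqW.
rewrite lt_eqF//; apply: lt_le_trans (zY _) _; first exact: leq_ltn_trans kn.
by apply: simplex_le => //; rewrite ltnS ltnW.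
Qed.

Definition node_sup (Y U : nat -> R) (j : nat) : R := Num.max (Y j) (U j).

(** For interval [j], take a maximum point of the system with the larger [j]-th node: it lies to the
    right of both [j]-th nodes, and to the left of its own next node, hence of the joined one. *)
Lemma regular_join (Y U : nat -> R) : regular Y -> regular U -> regular (node_sup Y U).
Proof.
move=> rY rU; have [sY _] := rY; have [sU _] := rU.
have sV : simplex (node_sup Y U).
  have [Y0 Y1 Ymono] := sY; have [U0 U1 Umono] := sU; rewrite /node_sup.
  split=> [||j jn]; rewrite ?Y0 ?U0 ?Y1 ?U1 ?maxxx//.
  by rewrite ge_max !le_max Ymono// Umono// orbT.
have Vint k : (k < n)%N -> 0 < node_sup Y U k.+1 < 1.
  move=> kn; have := regular_interior _ _ rY kn; have := regular_interior _ _ rU kn.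
  by rewrite lt_max gt_max => /andP[-> ->] /andP[-> ->].
split=> // j jn.
have main X Z : regular X -> (forall i, node_sup Y U i = node_sup X Z i) ->
    Z j <= X j -> 0 < M (node_sup Y U) j.
  move=> rX VE ZX; have [z [zX Xz zX' Fz _]] := regular_maxP _ _ rX jn.
  have [sX MX] := rX; have z01 := simplex_itv01 _ _ _ sX jn zX.
  apply: (node_max_gt0 _ _ z) => //.
  - rewrite lt_neqAle w_ge0// andbT eq_sym; apply/eqP => wz.
    by move: (MX _ jn); rewrite -Fz /F wz mul0r ltxx.
  - by move=> /Xz Xjz; rewrite VE /node_sup max_l.
  - by move=> /zX' zXj; rewrite VE /node_sup lt_max zXj.
have [YU|/ltW UY] := leP (Y j) (U j); last exact: (main Y U).
by apply: (main U Y) => // i; rewrite /node_sup maxC.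
Qed.

(** * Comparison of maxima when nodes are raised *)

Hypothesis swapL : forall k (a p q : R), 0 <= a -> 0 <= p -> 0 <= q -> a + p + q < 1 ->
  L k a * L k (a + p + q) <= L k (a + p) * L k (a + q).
Hypothesis crossL : forall k (s t y u : R), 0 <= s -> t <= 1 -> s < y -> y < u -> u < t ->
  L k (y - s) * L k (t - u) < L k (u - s) * L k (t - y).

(** Let [s] be a maximum point for [U] left of the common node and [t] one for [Y] right of it. Then
    [s] also lies in the interval of [Y] and [t] in that of [U], so it suffices to compare the
    values at [s] and [t], which is done factor by factor. *)
Lemma node_max_swap (Y U : nat -> R) (j : nat) : regular Y -> regular U ->
  (forall k, (k <= n.+1)%N -> Y k <= U k) -> (j < n)%N -> Y j.+1 = U j.+1 ->
  M U j * M Y j.+1 <= M Y j * M U j.+1.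
Proof.
move=> rY rU YU jn YUj; have [sY _] := rY; have [sU _] := rU.
have [s sU' [Fs _]] := node_maxP _ _ sU (ltnW jn).
have [t tY' [Ft _]] := node_maxP _ _ sY jn.
have s01 := simplex_itv01 _ _ _ sU (ltnW jn) sU'.
have t01 := simplex_itv01 _ _ _ sY jn tY'.
have st : s <= t by lra.
have sY' : Y j <= s <= Y j.+1 by have := YU j (leqW (ltnW jn)); lra.
have tU' : U j.+1 <= t <= U j.+2 by have := YU j.+2 jn; lra.
have U01 := simplex_in01 _ sU; have Y01 := simplex_in01 _ sY.
have MYs := node_max_ge _ _ _ sY (ltnW jn) sY'.
have MUt := node_max_ge _ _ _ sU jn tU'.
suff H : F U s * F Y t <= F Y s * F U t.
  rewrite -Fs -Ft; apply: le_trans H _.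
  by rewrite ler_pM ?node_fun_ge0.
rewrite /F /node_prod mulrACA [leRHS]mulrACA ler_wpM2l ?mulr_ge0 ?w_ge0//.
rewrite -!big_split/=; apply: ler_prod => k _.
have Yk := regular_interior _ _ rY (ltn_ord k).
have Uk := regular_interior _ _ rU (ltn_ord k).
have YUk : Y k.+1 <= U k.+1 by apply: YU; rewrite ltnS ltnW.
apply/andP; split; first by rewrite mulr_ge0// L_ge0// dist01//; lra.
(* The common node gives equality. Nodes of higher index lie to the right of both [s] and [t], those
   of lower index to the left, and either way the four distances form a swap. *)
have [kj|jk|kj] := ltngtP k j; last first.
- by rewrite kj YUj mulrC.
- have tYk : Y j.+2 <= Y k.+1 by apply: simplex_le => //; rewrite ltnS ltnW.
  have := @swapL k (Y k.+1 - t) (t - s) (U k.+1 - Y k.+1).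
  have -> : Y k.+1 - t + (t - s) = Y k.+1 - s by ring.
  have -> : Y k.+1 - s + (U k.+1 - Y k.+1) = U k.+1 - s by ring.
  have -> : Y k.+1 - t + (U k.+1 - Y k.+1) = U k.+1 - t by ring.
  have -> : `|s - U k.+1| = U k.+1 - s by rewrite distrC ger0_norm//; lra.
  have -> : `|s - Y k.+1| = Y k.+1 - s by rewrite distrC ger0_norm//; lra.
  have -> : `|t - U k.+1| = U k.+1 - t by rewrite distrC ger0_norm//; lra.
  have -> : `|t - Y k.+1| = Y k.+1 - t by rewrite distrC ger0_norm//; lra.
  by rewrite (mulrC (L k (U k.+1 - s))); apply; lra.
- have Usk : U k.+1 <= U j by apply: simplex_le => //; exact/leqW/ltnW.
  have := @swapL k (s - U k.+1) (U k.+1 - Y k.+1) (t - s).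
  have -> : s - U k.+1 + (U k.+1 - Y k.+1) = s - Y k.+1 by ring.
  have -> : s - Y k.+1 + (t - s) = t - Y k.+1 by ring.
  have -> : s - U k.+1 + (t - s) = t - U k.+1 by ring.
  have -> : `|s - U k.+1| = s - U k.+1 by rewrite ger0_norm//; lra.
  have -> : `|s - Y k.+1| = s - Y k.+1 by rewrite ger0_norm//; lra.
  have -> : `|t - U k.+1| = t - U k.+1 by rewrite ger0_norm//; lra.
  have -> : `|t - Y k.+1| = t - Y k.+1 by rewrite ger0_norm//; lra.
  by apply; lra.
Qed.

(** A first maximum point [s] of [Y] lies to the left of all nodes of both systems and a last
    maximum point [t] of [U] to the right. Each raised node then contributes a crossing inequality,
    strict at [k0]. *)
Lemma node_max_cross (Y U : nat -> R) (k0 : nat) : regular Y -> regular U ->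
  (forall k, (k <= n.+1)%N -> Y k <= U k) -> (k0 < n)%N -> Y k0.+1 < U k0.+1 ->
  M Y 0 * M U n < M U 0 * M Y n.
Proof.
move=> rY rU YU k0n YUk0; have [sY _] := rY; have [sU _] := rU.
have n0 : (0 < n)%N by exact: leq_ltn_trans k0n.
have [s [sY' _ /(_ n0) sY1 Fs _]] := regular_maxP _ _ rY (leq0n n).
have [t [tU' /(_ n0) Unt _ Ft _]] := regular_maxP _ _ rU (leqnn n).
have s01 := simplex_itv01 _ _ _ sY (leq0n n) sY'.
have t01 := simplex_itv01 _ _ _ sU (leqnn n) tU'.
have [Y0 Y1 _] := sY; have [U0 U1 _] := sU.
have sU' : U 0%N <= s <= U 1%N by have := YU 1%N isT; lra.
have tY' : Y n <= t <= Y n.+1 by have := YU n (leqnSn n); lra.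
have MUs := node_max_ge _ _ _ sU (leq0n n) sU'.
have MYt := node_max_ge _ _ _ sY (leqnn n) tY'.
have U01 := simplex_in01 _ sU; have Y01 := simplex_in01 _ sY.
suff H : F Y s * F U t < F U s * F Y t.
  rewrite -Fs -Ft; apply: lt_le_trans H _.
  by rewrite ler_pM ?node_fun_ge0.
have Fst : 0 < F Y s * F U t by rewrite Fs Ft mulr_gt0//; [case: rY|case: rU] => _; apply.
have order k : (k < n)%N -> [/\ s < Y k.+1, Y k.+1 <= U k.+1 & U k.+1 < t].
  move=> kn; split; [apply: lt_le_trans sY1 _|exact/YU/leqW|apply: le_lt_trans Unt].
    by apply: simplex_le => //; exact: leqW.
  by apply: simplex_le.
have dist k : (k < n)%N -> [/\ `|s - Y k.+1| = Y k.+1 - s, `|t - U k.+1| = t - U k.+1,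
    `|s - U k.+1| = U k.+1 - s & `|t - Y k.+1| = t - Y k.+1].
  by move=> /order[? ? ?]; split; rewrite ?(distrC s) ger0_norm//; lra.
move: Fst; rewrite /F /node_prod [in X in X -> _]mulrACA => Fst.
rewrite mulrACA [X in _ < X]mulrACA.
have ww : 0 < w s * w t.
  rewrite lt_neqAle mulr_ge0 ?w_ge0// andbT; apply: contraTneq Fst => <-.
  by rewrite mul0r ltxx.
rewrite ltr_pM2l// -!big_split/= (bigD1 (Ordinal k0n))//= [X in _ < X](bigD1 (Ordinal k0n))//=.
have pos k : (k < n)%N -> forall i, 0 < L i (Y k.+1 - s) /\ 0 < L i (t - U k.+1).
  move=> kn i; have [? ? ?] := order _ kn.
  have := regular_interior _ _ rY kn; have := regular_interior _ _ rU kn.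
  by move=> ? ?; split; apply: L_gt0; lra.
apply: (@lt_le_trans _ _ (L (Ordinal k0n) `|s - U k0.+1| * L (Ordinal k0n) `|t - Y k0.+1| *
   \prod_(i < n | i != Ordinal k0n) (L i `|s - Y i.+1| * L i `|t - U i.+1|))).
  rewrite ltr_pM2r; last first.
    apply: prodr_gt0 => i _; have [-> -> _ _] := dist _ (ltn_ord i).
    by have [? ?] := pos _ (ltn_ord i) i; rewrite mulr_gt0.
  have [-> -> -> ->] := dist _ k0n; have [? ? ?] := order _ k0n.
  by apply: crossL => //; lra.
rewrite ler_wpM2l//.
  by rewrite mulr_ge0// L_ge0// dist01 ?U01 ?Y01.
apply: ler_prod => i _; have [-> -> -> ->] := dist _ (ltn_ord i).
have [p1 p2] := pos _ (ltn_ord i) i; have [sYi YUi Uti] := order _ (ltn_ord i).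
rewrite mulr_ge0 ?(ltW p1) ?(ltW p2)//=.
have [->|ne] := eqVneq (Y i.+1) (U i.+1); first exact: lexx.
by apply/ltW/crossL; rewrite ?lt_neqAle ?ne//; lra.
Qed.

(** * Ratios of consecutive maxima *)

Definition log_ratio (Y : nat -> R) (j : nat) : R := ln (M Y j) - ln (M Y j.+1).

Lemma log_ratio_le (Y U : nat -> R) (j : nat) : regular Y -> regular U ->
  (forall k, (k <= n.+1)%N -> Y k <= U k) -> (j < n)%N -> Y j.+1 = U j.+1 ->
  log_ratio U j <= log_ratio Y j.
Proof.
move=> rY rU YU jn YUj; have [_ MY] := rY; have [_ MU] := rU.
have := node_max_swap _ _ _ rY rU YU jn YUj.
rewrite -ler_ln ?posrE ?mulr_gt0 ?MY ?MU// ?(ltnW jn)//.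
rewrite !lnM ?posrE ?MY ?MU ?(ltnW jn)// /log_ratio; lra.
Qed.

Lemma log_ratio_sum (Y : nat -> R) :
  \sum_(j < n) log_ratio Y j = ln (M Y 0) - ln (M Y n).
Proof.
rewrite -(big_mkord xpredT (log_ratio Y)) -[RHS]opprB.
rewrite -(telescope_sumr (fun j => ln (M Y j)) (leq0n n)) -sumrN.
by apply: eq_bigr => j _; rewrite opprB.
Qed.

Lemma log_ratio_sum_lt (Y U : nat -> R) (k0 : nat) : regular Y -> regular U ->
  (forall k, (k <= n.+1)%N -> Y k <= U k) -> (k0 < n)%N -> Y k0.+1 < U k0.+1 ->
  \sum_(j < n) log_ratio Y j < \sum_(j < n) log_ratio U j.
Proof.
move=> rY rU YU kn YUk; have [_ MY] := rY; have [_ MU] := rU.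
have := node_max_cross _ _ _ rY rU YU kn YUk.
rewrite !log_ratio_sum -ltr_ln ?posrE ?mulr_gt0 ?MY ?MU//.
rewrite !lnM ?posrE ?MY ?MU//; lra.
Qed.

(** Each node of the join comes from one of the two systems, so no ratio of the join exceeds the
    common value; a join strictly above [Y] would nevertheless have a larger sum. *)
Lemma log_ratio_inj_le (Y U : nat -> R) : regular Y -> regular U ->
  (forall j, (j < n)%N -> log_ratio Y j = log_ratio U j) ->
  forall k, (k < n)%N -> U k.+1 <= Y k.+1.
Proof.
move=> rY rU YU k kn; rewrite leNgt; apply/negP => YUk.
have rV := regular_join _ _ rY rU.
have YV i : (i <= n.+1)%N -> Y i <= node_sup Y U i by rewrite /node_sup le_max lexx.
have UV i : (i <= n.+1)%N -> U i <= node_sup Y U i by rewrite /node_sup le_max lexx orbT.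
have YVk : Y k.+1 < node_sup Y U k.+1 by rewrite /node_sup lt_max YUk orbT.
have := log_ratio_sum_lt _ _ _ rY rV YV kn YVk; rewrite ltNge => /negP; apply.
apply: ler_sum => j _; have [YUj|UYj] := leP (Y j.+1) (U j.+1).
  by rewrite YU//; apply: log_ratio_le => //; rewrite /node_sup max_r.
by apply: log_ratio_le => //; rewrite /node_sup max_l// ltW.
Qed.

Lemma log_ratio_inj (Y U : nat -> R) : regular Y -> regular U ->
  (forall j, (j < n)%N -> log_ratio Y j = log_ratio U j) ->
  forall k, (k < n)%N -> Y k.+1 = U k.+1.
Proof.
move=> rY rU YU k kn; apply/eqP; rewrite eq_le !log_ratio_inj_le// => j jn.
by rewrite YU.
Qed.

Lemma log_ratio_near (Y : nat -> R) (e : R) : regular Y -> 0 < e ->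
  exists2 d, 0 < d & forall U, simplex U ->
    (forall k, (k < n)%N -> `|Y k.+1 - U k.+1| < d) ->
    regular U /\ forall j, (j < n)%N -> `|log_ratio Y j - log_ratio U j| < e.
Proof.
move=> [sY MY] e0; have e20 : 0 < e / 2 by rewrite divr_gt0.
(* One radius [r] serves all [n + 1] maxima; [m] stands for the perturbed maximum. *)
have : \forall r \near (0:R)^'+, forall j : 'I_n.+1, forall m, `|M Y j - m| <= r ->
    0 < m /\ `|ln (M Y j) - ln m| < e / 2.
  apply: filter_forall => j; have Mj : 0 < M Y j by apply: MY; rewrite -ltnS.
  have /cvgrPdist_lt/(_ _ e20)/nbhs_ballP[d /= d0 Hd] := continuous_ln Mj.
  near=> r => m Mm; have rM : r < M Y j by near: r; exact: nbhs_right_lt.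
  split; first by move: Mm; rewrite ler_norml; lra.
  apply: Hd; rewrite /ball/=; apply: le_lt_trans Mm _.
  by near: r; exact: nbhs_right_lt.
move=> /nbhs_ballP[r /= r0 Hr].
have r20 : 0 < r / 2 by rewrite divr_gt0.
have [d d0 Hd] := node_max_uniform _ r20.
exists d => // U sU YU.
have H j : (j <= n)%N -> 0 < M U j /\ `|ln (M Y j) - ln (M U j)| < e / 2.
  move=> jn; apply: (Hr (r / 2) _ _ (Ordinal (jn : (j < n.+1)%N))) => //.
    by rewrite /ball/= sub0r normrN gtr0_norm//; lra.
  have H1 := Hd _ _ sY sU YU j jn.
  have H2 : M U j <= M Y j + r / 2.
    by apply: Hd => // k kn; rewrite distrC; exact: YU.
  by rewrite ler_norml/=; lra.
split; first by split=> // j /H[].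
move=> j jn; have [_ H1] := H j (ltnW jn); have [_ H2] := H j.+1 jn.
move: H1 H2; rewrite /log_ratio !ltr_norml; lra.
Unshelve. all: by end_near. Qed.

Definition move_node (Y : nat -> R) (i : nat) (e : R) (k : nat) : R :=
  if k == i then Y k + e else Y k.

Lemma move_nodeP (Y : nat -> R) (i : nat) (e : R) : regular Y -> (i < n)%N -> 0 < e ->
  exists2 d, 0 < d & forall h, `|h| <= d -> regular (move_node Y i.+1 h) /\
    forall j, (j < n)%N -> `|log_ratio Y j - log_ratio (move_node Y i.+1 h) j| < e.
Proof.
move=> rY iN e0; have [sY _] := rY; have [Y0 Y1 Ymono] := sY.
have [d d0 Hd] := log_ratio_near _ _ rY e0.
have g1 := regular_lt Y i rY (ltnW iN); have g2 := regular_lt Y i.+1 rY iN.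
pose m := Num.min (Y i.+1 - Y i) (Y i.+2 - Y i.+1).
have m0 : 0 < m by rewrite lt_min !subr_gt0 g1.
(* The gaps in [m] keep the moved node between its neighbours. Half of [d] turns the strict bound
   into a closed one, so that the extreme shift is itself allowed. *)
exists (Num.min m (d / 2)); first by rewrite lt_min m0 divr_gt0.
move=> h; rewrite !le_min => /andP[/andP[h1 h2] hd].
move: h1 h2; rewrite !ler_norml => /andP[h1 h1'] /andP[h2 h2'].
apply: Hd => [|k kn]; rewrite /move_node.
  split=> [//||j jn]; first by rewrite eqSS gtn_eqF.
  have := Ymono j jn; rewrite eqSS; case: (eqVneq j i.+1) => [->|ji].
    by rewrite gtn_eqF//; lra.
  by case: eqP => [->|]; lra.
case: eqP => _; last by rewrite subrr normr0.
rewrite opprD addrA subrr sub0r normrN; apply: le_lt_trans hd _; lra.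
Qed.

(** * Descent of the total defect *)

Variable b : nat -> R.

Definition residual (Y : nat -> R) : R := \sum_(j < n) `|log_ratio Y j - b j|.

(* Moving one node against the sign of its defect corrects that defect by at
   least as much as it perturbs all the other ones. *)
Lemma residual_descent (Y : nat -> R) (i : nat) : regular Y -> (i < n)%N ->
  log_ratio Y i != b i -> exists2 U, regular U & residual U < residual Y.
Proof.
move=> rY iN neq.
have e0 : 0 < `|log_ratio Y i - b i| by rewrite normr_gt0 subr_eq0.
(* The tolerance is the defect itself, so the corrected ratio cannot overshoot [b i]. *)
have [d d0 Hd] := move_nodeP _ _ _ rY iN e0.
have same h k : k != i.+1 -> Y k = move_node Y i.+1 h k.
  by rewrite /move_node => /negbTE ->.
have residual_lt U : \sum_(j < n) (log_ratio U j - log_ratio Y j) < 0 ->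
    (forall j, (j < n)%N -> `|log_ratio U j - b j| <=
      `|log_ratio Y j - b j| + (log_ratio U j - log_ratio Y j)) ->
    residual U < residual Y.
  move=> neg H; apply: (@le_lt_trans _ _
    (residual Y + \sum_(j < n) (log_ratio U j - log_ratio Y j))); last by lra.
  by rewrite -big_split; apply: ler_sum => j _; exact: H.
have residual_gt U : \sum_(j < n) (log_ratio Y j - log_ratio U j) < 0 ->
    (forall j, (j < n)%N -> `|log_ratio U j - b j| <=
      `|log_ratio Y j - b j| + (log_ratio Y j - log_ratio U j)) ->
    residual U < residual Y.
  move=> neg H; apply: (@le_lt_trans _ _
    (residual Y + \sum_(j < n) (log_ratio Y j - log_ratio U j))); last by lra.
  by rewrite -big_split; apply: ler_sum => j _; exact: H.
(* Raising the node increases the sum of all ratios while the others do not increase, so ratio [i]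
   gains more than the others lose in total; lowering the node is the mirror case. *)
have [lt_b|gt_b] := ltP (log_ratio Y i) (b i).
  have [|rU close] := Hd d; first by rewrite (gtr0_norm d0).
  set U := move_node Y i.+1 d in rU close.
  have YU k : (k <= n.+1)%N -> Y k <= U k.
    by rewrite /U /move_node; case: eqP => // _; lra.
  have YUi : Y i.+1 < U i.+1 by rewrite /U /move_node eqxx; lra.
  exists U => //; apply: residual_gt.
    by rewrite sumrB subr_lt0; exact: log_ratio_sum_lt YUi.
  move=> j jn; have [ji|ji] := eqVneq j i.
    have E : `|log_ratio Y i - b i| = b i - log_ratio Y i by rewrite distrC gtr0_norm// subr_gt0.
    have := close _ jn; rewrite ji E ltr_norml => /andP[H1 H2].
    by rewrite distrC ger0_norm; lra.
  have : log_ratio U j <= log_ratio Y j.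
    by apply: log_ratio_le => //; apply: same; rewrite eqSS.
  have := ler_normD (log_ratio Y j - b j) (log_ratio U j - log_ratio Y j).
  have -> : log_ratio Y j - b j + (log_ratio U j - log_ratio Y j) =
    log_ratio U j - b j by ring.
  move=> H1 H2; have E : `|log_ratio U j - log_ratio Y j| = log_ratio Y j - log_ratio U j.
    by rewrite distrC ger0_norm// subr_ge0.
  by rewrite E in H1.
have [|rU close] := Hd (- d); first by rewrite normrN gtr0_norm.
set U := move_node Y i.+1 (- d) in rU close.
have UY k : (k <= n.+1)%N -> U k <= Y k.
  by rewrite /U /move_node; case: eqP => // _; lra.
have UYi : U i.+1 < Y i.+1 by rewrite /U /move_node eqxx; lra.
exists U => //; apply: residual_lt.
  by rewrite sumrB subr_lt0; exact: log_ratio_sum_lt UYi.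
move=> j jn; have [ji|ji] := eqVneq j i.
  have E : `|log_ratio Y i - b i| = log_ratio Y i - b i by rewrite ger0_norm// subr_ge0.
  have := close _ jn; rewrite ji E ltr_norml => /andP[H1 H2].
  by rewrite ger0_norm; lra.
have : log_ratio Y j <= log_ratio U j.
  by apply: log_ratio_le => //; apply/esym/same; rewrite eqSS.
have := ler_normD (log_ratio Y j - b j) (log_ratio U j - log_ratio Y j).
have -> : log_ratio Y j - b j + (log_ratio U j - log_ratio Y j) =
  log_ratio U j - b j by ring.
by move=> H1 H2; move: H1; rewrite [X in _ <= _ + X]ger0_norm// subr_ge0.
Qed.

Lemma residual_near (Y : nat -> R) (e : R) : regular Y -> 0 < e ->
  exists2 d, 0 < d & forall U, simplex U ->
    (forall k, (k < n)%N -> `|Y k.+1 - U k.+1| < d) -> `|residual Y - residual U| < e.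
Proof.
move=> rY e0.
(* Dividing by [n + 1] covers [n = 0] and keeps the sum of [n] errors strictly below [e]. *)
have n0 : 0 < n.+1%:R :> R by rewrite ltr0n.
have [d d0 Hd] := log_ratio_near _ _ rY (divr_gt0 e0 n0).
exists d => // U sU YU; have [_ close] := Hd _ sU YU.
rewrite -sumrB; apply: le_lt_trans (ler_norm_sum _ _ _) _.
apply: (@le_lt_trans _ _ (\sum_(j < n) e / n.+1%:R)).
  apply: ler_sum => j _; apply: le_trans (ler_dist_dist _ _) _.
  have -> : log_ratio Y j - b j - (log_ratio U j - b j) = log_ratio Y j - log_ratio U j by ring.
  exact/ltW/close.
rewrite sumr_const card_ord -[_ *+ n]mulr_natr mulrAC ltr_pdivrMr// ltr_pM2l//.
by rewrite ltr_nat.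
Qed.

(** * Existence of a minimiser *)

(** Systems are coded by row vectors to use compactness of the cube; the default [1] supplies the
    right end at index [n + 1]. *)
Definition row_nodes (v : 'rV[R]_n) (j : nat) : R :=
  if j is k.+1 then if insub k is Some i then v ord0 i else 1 else 0.

Lemma row_nodesS (v : 'rV[R]_n) (k : 'I_n) : row_nodes v k.+1 = v ord0 k.
Proof. by rewrite /row_nodes valK. Qed.

Lemma row_nodes_last (v : 'rV[R]_n) : row_nodes v n.+1 = 1.
Proof. by rewrite /row_nodes insubF// ltnn. Qed.

Lemma row_nodes_row (Y : nat -> R) (k : nat) : simplex Y -> (k <= n.+1)%N ->
  row_nodes (\row_(i < n) Y i.+1) k = Y k.
Proof.
move=> [Y0 Y1 _]; case: k => [|k]; first by rewrite Y0.
rewrite ltnS leq_eqVlt => /predU1P[->|kn]; first by rewrite row_nodes_last Y1.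
by rewrite (row_nodesS _ (Ordinal kn)) mxE.
Qed.

Lemma row_nodes_ball (v u : 'rV[R]_n) (e : R) (k : nat) : 0 < e -> ball v e u ->
  `|row_nodes v k - row_nodes u k| < e.
Proof.
move=> e0 [_ vu]; case: k => [|k]; first by rewrite subrr normr0.
by rewrite /row_nodes; case: insubP => [i _ _|_]; [exact: vu|rewrite subrr normr0].
Qed.

(** Bounded ratios written without division, so that the condition makes sense for vanishing maxima
    and passes to limits. *)
Definition balanced (B : R) (Y : nat -> R) : Prop := simplex Y /\
  forall j, (j < n)%N -> M Y j <= B * M Y j.+1 /\ M Y j.+1 <= B * M Y j.

Lemma closed_balanced (B : R) : 0 < B -> closed [set v | balanced B (row_nodes v)].
Proof.
move=> B0 v clv.
have near e : 0 < e -> exists2 u, balanced B (row_nodes u) &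
    forall k, `|row_nodes v k - row_nodes u k| < e.
  move=> e0; have [u [Bu vu]] := clv _ (nbhsx_ballx v _ e0).
  by exists u => // k; exact: row_nodes_ball.
have sv : simplex (row_nodes v).
  split=> [//||j jn]; first exact: row_nodes_last.
  apply/ler_addgt0Pr => e e0; have e20 : 0 < e / 2 by rewrite divr_gt0.
  have [u [[_ _ umono] _] vu] := near _ e20.
  have := umono j jn; have := vu j; have := vu j.+1.
  by rewrite !ltr_norml; lra.
have close e : 0 < e -> exists2 u, balanced B (row_nodes u) & forall j, (j <= n)%N ->
    M (row_nodes v) j <= M (row_nodes u) j + e /\ M (row_nodes u) j <= M (row_nodes v) j + e.
  move=> e0; have [d d0 Hd] := node_max_uniform _ e0.
  have [u [su Bu] vu] := near _ d0; exists u => // j jn.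
  by split; apply: Hd => // k _; rewrite 1?distrC.
have B1 : 0 < 1 + B by rewrite addr_gt0.
split=> // j jn; split; apply/ler_addgt0Pr => e e0.
  (* Replacing both maxima by approximations costs [e1] on the left and [B * e1] on the right, [e]
     in total. *)
  pose e1 := e / (1 + B); have e10 : 0 < e1 by rewrite divr_gt0.
  have Ee : e = e1 + B * e1 by rewrite /e1; field; rewrite gt_eqF.
  have [u [su Bu] vu] := close _ e10.
  have [H1 _] := vu j (ltnW jn); have [_ H2] := vu j.+1 jn; have [H3 _] := Bu j jn.
  have := ler_wpM2l (ltW B0) H2; lra.
pose e1 := e / (1 + B); have e10 : 0 < e1 by rewrite divr_gt0.
have Ee : e = e1 + B * e1 by rewrite /e1; field; rewrite gt_eqF.
have [u [su Bu] vu] := close _ e10.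
have [_ H2] := vu j (ltnW jn); have [H1 _] := vu j.+1 jn; have [_ H3] := Bu j jn.
have := ler_wpM2l (ltW B0) H2; lra.
Qed.

Lemma compact_balanced (B : R) : 0 < B -> compact [set v | balanced B (row_nodes v)].
Proof.
move=> B0.
have box := @rV_compact R n (fun=> `[0, 1]%classic) (fun=> @segment_compact R 0 1).
apply: (subclosed_compact (closed_balanced _ B0) box) => v [sv _] i /=.
by rewrite in_itv/= -row_nodesS simplex01// ltnS ltnW.
Qed.

(** * Nondegeneracy from the points of nonzero weight *)

Variable p : 'I_n.+1 -> R.
Hypothesis p_inj : injective p.
Hypothesis pP : forall i, 0 < p i < 1 /\ w (p i) != 0.

Let w_gt0 i : 0 < w (p i).
Proof. by have [p01 wp] := pP i; rewrite lt_neqAle eq_sym wp w_ge0//; lra. Qed.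

Lemma simplex_locate (Y : nat -> R) (t : R) : simplex Y -> 0 <= t <= 1 ->
  exists2 j, (j <= n)%N & Y j <= t <= Y j.+1.
Proof.
move=> [Y0 Y1 _] /andP[t0 t1].
suff H m : t <= Y m.+1 -> exists2 j, (j <= m)%N & Y j <= t <= Y j.+1.
  by apply: H; rewrite Y1.
elim: m => [|m IH] tm; first by exists 0%N => //; rewrite Y0 t0.
have [/IH[j jm tj]|mt] := leP t (Y m.+1); first by exists j => //; exact: leqW.
by exists m.+1 => //; rewrite ltW.
Qed.

(* [n] nodes cannot cover the [n + 1] points where the weight is nonzero. *)
Lemma simplex_max_gt0 (Y : nat -> R) : simplex Y -> exists2 j, (j <= n)%N & 0 < M Y j.
Proof.
move=> sY; have [i pi] : exists i, forall k : 'I_n, p i != Y k.+1.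
  apply: contrapT => /forallNP H.
  have {}H i : {k : 'I_n | p i = Y k.+1}.
    by apply: cid; have /existsNP[k /negP/negPn/eqP] := H i; exists k.
  have : injective (fun i => sval (H i)).
    move=> i i' E; apply: p_inj; rewrite (svalP (H i)) (svalP (H i')).
    by congr (Y _.+1); congr (nat_of_ord _).
  by move=> /leq_card; rewrite !card_ord ltnn.
have [p01 _] := pP i; have p01' : 0 <= p i <= 1 by lra.
have [j jn pj] := simplex_locate _ _ sY p01'; exists j => //.
apply: lt_le_trans (node_max_ge _ _ _ sY jn pj); apply: node_fun_gt0 => // k kn.
split; first exact: (pi (Ordinal kn)).
by have := simplex01 Y k.+1 sY (leqW kn); rewrite ltr_norml; lra.
Qed.

(** Some maximum is positive, and the two-sided ratio bounds carry positivity to its neighbours in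
    both directions. *)
Lemma balanced_regular (B : R) (Y : nat -> R) : 0 < B -> balanced B Y -> regular Y.
Proof.
move=> B0 [sY BY]; split=> //; have [j jn Mj] := simplex_max_gt0 _ sY.
have up i : (i < n)%N -> 0 < M Y i -> 0 < M Y i.+1.
  by move=> /BY[H _] /lt_le_trans/(_ H); rewrite pmulr_rgt0.
have down i : (i < n)%N -> 0 < M Y i.+1 -> 0 < M Y i.
  by move=> /BY[_ H] /lt_le_trans/(_ H); rewrite pmulr_rgt0.
have M0 : 0 < M Y 0.
  elim: j jn Mj => // j IH jn /down Mj; apply: IH (Mj _); rewrite ?(ltnW jn)//.
by elim=> // i IH iN; apply: up => //; apply/IH/ltnW.
Qed.

Lemma regular_balanced (Y : nat -> R) (r : R) : regular Y ->
  (forall j, (j < n)%N -> `|log_ratio Y j| <= r) -> balanced (expR r) Y.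
Proof.
move=> [sY MY] Hr; split=> // j jn.
have M1 := MY j (ltnW jn); have M2 := MY j.+1 jn.
have := Hr j jn; rewrite /log_ratio ler_norml => H.
have e0 := expR_gt0 r.
split; rewrite -ler_ln ?posrE ?mulr_gt0// lnM ?posrE// expRK; lra.
Qed.

(** With the [n + 1] points sorted and the nodes at midpoints of consecutive ones, every interval
    contains a point of positive weight. *)
Lemma regular_ex : exists Y, regular Y.
Proof.
pose s := sort <=%R [seq p i | i <- enum 'I_n.+1].
have size_s : size s = n.+1 by rewrite size_sort size_map size_enum_ord.
have s_lt i j : (i < j)%N -> (j <= n)%N -> s`_i < s`_j.
  move=> ij jn; apply: (sorted_ltn_nth lt_trans) => //; last first.
  - by rewrite inE size_s.
  - by rewrite inE size_s ltnS (leq_trans (ltnW ij)).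
  by rewrite lt_sorted_uniq_le sort_uniq map_inj_uniq ?enum_uniq//= sort_le_sorted.
have sP j : (j <= n)%N -> 0 < s`_j < 1 /\ 0 < w s`_j.
  move=> jn; have : s`_j \in s by rewrite mem_nth// size_s.
  by rewrite mem_sort => /mapP[i _ ->]; have [? _] := pP i.
pose Y j := if j is k.+1 then if (k < n)%N then (s`_k + s`_k.+1) / 2 else 1 else 0.
have Yl j : (j <= n)%N -> Y j < s`_j.
  case: j => [|j] jn; first by have [/andP[]] := sP 0%N jn.
  by rewrite /Y jn; have := s_lt j j.+1 (leqnn _) jn; lra.
have Yr j : (j <= n)%N -> s`_j < Y j.+1.
  move=> jn; rewrite /Y; case: ifP => jn'; last by have [/andP[]] := sP j jn.
  by have := s_lt j j.+1 (leqnn _) jn'; lra.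
have sY : simplex Y.
  split=> [//||j jn]; first by rewrite /Y ltnn.
  exact/ltW/(lt_trans (Yl j jn))/Yr.
exists Y; split=> // j jn; have [s01 ws] := sP j jn.
apply: (node_max_gt0 _ _ s`_j) => //; last 3 first.
- by lra.
- by move=> _; exact: Yl.
- by move=> _; exact: Yr.
move=> k kn; rewrite /Y kn; have [? _] := sP k (ltnW kn); have [? _] := sP k.+1 kn.
lra.
Qed.

Lemma residual_min : exists2 Y, regular Y & forall U, regular U -> residual Y <= residual U.
Proof.
have [Y0 rY0] := regular_ex; have [sY0 _] := rY0.
(* Each [|log_ratio Y j|] is at most [residual Y + |b j|], so [r] bounds the ratios on the sublevel
   set of [Y0] and places it in a compact set. *)
pose r := residual Y0 + \sum_(j < n) `|b j|.
pose A : set 'rV[R]_n := [set v | balanced (expR r) (row_nodes v)].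
pose row Y : 'rV[R]_n := \row_(i < n) Y i.+1.
have M_row Y j : simplex Y -> (j <= n)%N -> M (row_nodes (row Y)) j = M Y j.
  by move=> sY jn; apply: node_max_eq => // k kn; exact: row_nodes_row.
have res_row Y : simplex Y -> residual (row_nodes (row Y)) = residual Y.
  move=> sY; apply: eq_bigr => j _; rewrite /log_ratio !M_row//.
  exact: ltnW.
have A_row Y : regular Y -> residual Y <= residual Y0 -> A (row Y).
  move=> rY resY; have [sY _] := rY.
  have [] : balanced (expR r) Y.
    apply: regular_balanced => // j jn.
    have -> : log_ratio Y j = (log_ratio Y j - b j) + b j by ring.
    apply: le_trans (ler_normD _ _) _; apply: lerD; last first.
      by rewrite (bigD1 (Ordinal jn))//= lerDl sumr_ge0.
    apply: le_trans resY; rewrite /residual (bigD1 (Ordinal jn))//= lerDl.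
    exact: sumr_ge0.
  move=> _ BY; split=> [|j jn]; last by rewrite !M_row// ?(ltnW jn)//; exact: BY.
  have [Y0' Y1' mono] := sY; split=> [//||j jn]; first exact: row_nodes_last.
  by rewrite !row_nodes_row//; [exact: mono|exact: leqW].
have A0 : A !=set0 by exists (row Y0); exact: A_row.
have [|v] := compact_EVT_min (f := fun v => residual (row_nodes v)) A0
    (compact_balanced _ (expR_gt0 r)).
  apply/subspace_continuousP => v Av; apply/cvgrPdist_lt => e e0.
  have rv := balanced_regular _ _ (expR_gt0 r) Av.
  have [d d0 Hd] := residual_near _ _ rv e0.
  rewrite near_withinE; apply/nbhs_ballP; exists d => //= u vu [su _].
  by apply: Hd => // k _; exact: row_nodes_ball.
rewrite inE => Av Hv; exists (row_nodes v).
  exact: balanced_regular (expR_gt0 r) Av.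
have resv U : regular U -> residual U <= residual Y0 -> residual (row_nodes v) <= residual U.
  move=> rU resU; have [sU _] := rU.
  by rewrite -(res_row U)//; apply: Hv; rewrite inE; exact: A_row.
move=> U rU; have [|/ltW resU] := leP (residual U) (residual Y0); first exact: resv.
by apply: le_trans resU; exact: resv.
Qed.

Lemma regular_log_ratio_ex : exists2 Y, regular Y &
  forall j, (j < n)%N -> log_ratio Y j = b j.
Proof.
have [Y rY minY] := residual_min; exists Y => // j jn.
apply/eqP/negP => /negP neq; have [U rU] := residual_descent _ _ rY jn neq.
by rewrite ltNge minY.
Qed.

(** * Regular systems as solutions of the original problem *)

Lemma GfunE (y : seq R) (C t : R) : Gfun L w y C t = C * F (ybar y) t.
Proof. by rewrite /Gfun /node_fun mulrA. Qed.

Lemma good_system_regular (alpha : nat -> R) (y : seq R) (C : R) :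
  (forall j, (j <= n)%N -> 0 < alpha j) -> good_system L w alpha y C ->
  regular (ybar y) /\ forall j, (j <= n)%N -> C * M (ybar y) j = alpha j.
Proof.
move=> alpha0 [sy mono C0 [z [_ _ zP]]].
have sY : simplex (ybar y).
  by split=> [//||j jn]; [rewrite /ybar nth_default//= sy|apply: ltW; exact: mono].
have CM j : (j <= n)%N -> C * M (ybar y) j = alpha j.
  move=> jn; have [_ _ zj Gz Gmax] := zP j jn; rewrite -Gz GfunE; congr (_ * _).
  have [u uj [<- umax]] := node_maxP _ _ sY jn.
  apply/eqP; rewrite eq_le umax// andbT.
  by have := Gmax u uj; rewrite !GfunE ler_pM2l.
by split=> //; split=> // j jn; rewrite -(pmulr_rgt0 _ C0) CM// alpha0.
Qed.

Lemma regular_good_system (alpha : nat -> R) (Y : nat -> R) (C : R) : 0 < C ->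
  regular Y -> (forall j, (j <= n)%N -> C * M Y j = alpha j) ->
  good_system L w alpha (mkseq (fun k => Y k.+1) n) C.
Proof.
move=> C0 rY CM; have [[Y0 Y1 _] _] := rY; set y := mkseq _ _.
have sy : size y = n by rewrite size_mkseq.
have yY j : (j <= n.+1)%N -> ybar y j = Y j.
  case: j => [|j]; rewrite /ybar/= ?Y0//.
  rewrite ltnS leq_eqVlt => /predU1P[->|jn]; first by rewrite nth_default ?sy ?Y1.
  by rewrite nth_mkseq.
have ry : regular (ybar y).
  split; first by split=> [||j jn]; rewrite ?yY// ?(leqW jn)//; exact/ltW/regular_lt.
  by move=> j jn; rewrite (node_max_eq _ Y)//; have [_] := rY; apply.
(* The guard [j <= n] makes the choice total in [j]; beyond [n] the value [0] is a dummy. *)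
have zP j : {z : R | (j <= n)%N -> [/\ ybar y j <= z <= ybar y j.+1,
    (0 < j)%N -> ybar y j < z, (j < n)%N -> z < ybar y j.+1,
    F (ybar y) z = M (ybar y) j &
    forall t, ybar y j <= t <= ybar y j.+1 -> F (ybar y) t <= F (ybar y) z]}.
  apply: cid; case: (leqP j n) => [jn|_]; last by exists 0.
  by have [z Hz] := regular_maxP _ _ ry jn; exists z.
split=> // [j jn|]; first exact: regular_lt.
exists (fun j => sval (zP j)); split.
- by have [/andP[]] := svalP (zP 0%N) (leq0n n).
- have [/andP[_ zn1] _ _ _ _] := svalP (zP n) (leqnn n).
  by apply: le_trans zn1 _; rewrite yY// Y1.
move=> j jn; have [z1 z2 z3 Fz Fmax] := svalP (zP j) jn.
split=> // [|t tj]; rewrite !GfunE; last by rewrite ler_pM2l// Fmax.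
by rewrite Fz (node_max_eq _ Y)// CM.
Qed.

(** The ratios determine the maxima up to a common factor, and the equation at index [0] fixes that
    factor. This separates the nodes from [C]. *)
Lemma log_ratio_alpha (alpha : nat -> R) (Y : nat -> R) (C : R) : 0 < C ->
  regular Y -> (forall j, (j <= n)%N -> 0 < alpha j) ->
  (forall j, (j <= n)%N -> C * M Y j = alpha j) <->
  C * M Y 0 = alpha 0%N /\
  forall j, (j < n)%N -> log_ratio Y j = ln (alpha j) - ln (alpha j.+1).
Proof.
move=> C0 [_ MY] alpha0; split=> [CM|[CM0 ratio]].
  split=> [|j jn]; first exact: CM.
  by rewrite -!CM ?(ltnW jn)// !lnM ?posrE ?MY ?(ltnW jn)// /log_ratio; ring.
elim=> // j IH jn; have := ratio j jn; rewrite /log_ratio -IH ?(ltnW jn)//.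
rewrite lnM ?posrE ?MY ?(ltnW jn)// => H.
apply: ln_inj; rewrite ?posrE ?mulr_gt0 ?MY ?alpha0//.
rewrite lnM ?posrE ?MY//; lra.
Qed.

End Nodes.

Theorem theorem9p9 (R : realType) (n : nat) (L : 'I_n -> R -> R) (c : R)
  (w : R -> R) :
  (forall k, {within `[0, 1], continuous (L k)}) ->
  (forall k t, 0 <= t <= 1 -> 0 <= L k t) ->
  (forall k, L k 0 = 0) ->
  (forall k t, 0 < t < 1 -> 0 < L k t) ->
  (forall k, concave_on_open 0 1 (fun t => ln (L k t))) ->
  0 < c ->
  (forall k, \forall t \ae (@lebesgue_measure R), 0 < t < 1 ->
      derivable (fun s => ln (L k s / L k (1 - s))) t 1 /\
      c <= derive1 (fun s => ln (L k s / L k (1 - s))) t) ->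
  (forall t, 0 <= t <= 1 -> 0 <= w t) ->
  usc_on01 w ->
  (exists p : 'I_n.+1 -> R, injective p /\
     forall i, 0 < p i < 1 /\ w (p i) != 0) ->
  forall alpha : nat -> R, (forall j, (j <= n)%N -> 0 < alpha j) ->
  exists y : seq R, exists C : R,
    good_system L w alpha y C /\
    forall (y' : seq R) (C' : R), good_system L w alpha y' C' -> y' = y /\ C' = C.
Proof.
move=> contL L_ge0 L0 L_gt0 concL c0 slopeL w_ge0 uscw [p [p_inj pP]] alpha alpha0.
have swapL k (a q r : R) : 0 <= a -> 0 <= q -> 0 <= r -> a + q + r < 1 ->
    L k a * L k (a + q + r) <= L k (a + q) * L k (a + r).
  exact: (factor_swap _ _ (L_ge0 k) (L0 k) (L_gt0 k) (concL k)).
have crossL k (s t y u : R) : 0 <= s -> t <= 1 -> s < y -> y < u -> u < t ->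
    L k (y - s) * L k (t - u) < L k (u - s) * L k (t - y).
  exact: (factor_cross_lt _ _ _ (contL k) (L_ge0 k) (L0 k) (L_gt0 k) (concL k) c0 (slopeL k)).
pose b j := ln (alpha j) - ln (alpha j.+1).
have [Y rY ratioY] := regular_log_ratio_ex _ _ _ _ contL L_ge0 L0 L_gt0 w_ge0 uscw
  swapL crossL b _ p_inj pP.
have MY0 : 0 < node_max _ _ L w Y 0 by have [_] := rY; apply.
have C0 : 0 < alpha 0%N / node_max _ _ L w Y 0 by rewrite divr_gt0// alpha0.
exists (mkseq (fun k => Y k.+1) n), (alpha 0%N / node_max _ _ L w Y 0); split.
  apply: regular_good_system => //; apply/log_ratio_alpha => //.
  by rewrite divfK// gt_eqF.
move=> y C good; have [sy _ C_gt0 _] := good.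
have [ry CMy] := good_system_regular _ _ _ _ contL L_ge0 w_ge0 uscw _ _ _ alpha0 good.
have [_ ratioy] := (log_ratio_alpha _ _ _ _ _ _ _ C_gt0 ry alpha0).1 CMy.
have [[Y0 Y1 _] _] := rY; have [[y0 y1 _] _] := ry.
have yY k : (k < n)%N -> ybar y k.+1 = Y k.+1.
  apply: (log_ratio_inj _ _ L w) => // j jn.
  by rewrite ratioy// ratioY.
split.
  apply: (@eq_from_nth _ 1) => [|k]; rewrite ?size_mkseq// sy => kn.
  by rewrite nth_mkseq//; exact: yY.
(* With equal nodes the maxima over the first interval agree, and [C] is [alpha 0] divided by this
   maximum. *)
have <- : node_max _ _ L w (ybar y) 0 = node_max _ _ L w Y 0.
  apply: node_max_eq => // -[|k]; first by rewrite y0 Y0.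
  by rewrite ltnS leq_eqVlt => /predU1P[->|/yY//]; rewrite y1 Y1.
by rewrite -CMy// mulfK// gt_eqF//; have [_] := ry; apply.
Qed.
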